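(* Let $h,g\in\mathcal{E}$ be (generalised) excursions on $[0,1]$, and let $\mathcal{T}_h,\mathcal{T}_g$ be the metric measure spaces coded by them. Then $$ d_{\mathrm{GP}}(\mathcal{T}_h,\mathcal{T}_g)\ \le\ 2\,\|h-g\| = 2\sup_{t\in[0,1]}|h(t)-g(t)|. $$
   Context: A metric measure space (mm-space) is a triple $(X,d,\mu)$ where $(X,d)$ is a complete separable metric space and $\mu$ is a probability measure on the Borel $\sigma$-algebra of $X$. Two mm-spaces $(X,d,\mu)$ and $(X',d',\mu')$ are isomorphic (and are not distinguished) if there is a measure preserving map $f\colon X\to X'$ (i.e. $\mu'=\mu\circ f^{-1}$) with $d(x,y)=d'(f(x),f(y))$ for all $x,y\in\mathrm{supp}(\mu)$. Prohorov distance: for probability measures $\mu,\nu$ on a metric space $(X,d)$, $d_{\mathrm{Pr}}(\mu,\nu)=\inf\{\varepsilon>0 : \mu(A)\le \nu(A^\varepsilon)+\varepsilon \text{ for all Borel } A\subseteq X\}$, where $A^\varepsilon=\{x\in X: d(A,x)<\varepsilon\}$. Gromov-Prohorov metric: for mm-spaces $\mathcal{X}_i=(X_i,d_i,\mu_i)$, $i=1,2$, $d_{\mathrm{GP}}(\mathcal{X}_1,\mathcal{X}_2)=\inf_{f,g} d_{\mathrm{Pr}}(\mu_1\circ f^{-1},\mu_2\circ g^{-1})$, where the infimum is over all isometries (isometric embeddings) $f\colon X_1\to X$, $g\colon X_2\to X$ into a common separable metric space $(X,d)$. Excursions: $\mathcal{E}=\{h\colon[0,1]\to\mathbb{R}_+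 : h(0)=0,\ h \text{ lower semi-continuous}\}$, where $\mathbb{R}_+=[0,\infty)$. Coded spaces: for $h\in\mathcal{E}$ and $s,t\in[0,1]$ let $I_h(s,t)=\inf_{u\in[s\wedge t,\,s\vee t]}h(u)$ and $d_h(s,t)=h(s)+h(t)-2I_h(s,t)$. This is a semi-metric (pseudo-metric) on $[0,1]$; let $T_h=[0,1]/d_h$ be the quotient metric space (identifying points at $d_h$-distance $0$), with metric again denoted $d_h$, and $\pi_h\colon[0,1]\to T_h$ the natural projection. For $h\in\mathcal{E}$, $T_h$ is separable and $\pi_h$ is measurable; $T_h$ is identified with its completion. Let $\mu_h=\lambda\circ\pi_h^{-1}$ be the image under $\pi_h$ of Lebesgue measure $\lambda$ on $[0,1]$. Then $\mathcal{T}_h=(T_h,d_h,\mu_h)$ is an mm-space. *)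

(* Defs.v *)
From HB Require Import structures.
From mathcomp Require Import all_boot all_order all_algebra generic_quotient.
From mathcomp Require Import all_classical all_reals all_analysis.
From mathcomp Require Import measurable_realfun.
From mathcomp Require Import ring lra.
Set Implicit Arguments.
Unset Strict Implicit.
Unset Printing Implicit Defensive.
Import Order.TTheory GRing.Theory Num.Theory.
Import numFieldTopology.Exports numFieldNormedType.Exports.

Local Open Scope classical_set_scope.
Local Open Scope ring_scope.
Local Open Scope quotient_scope.

(* Base points are only there because measurableType requires them; a space
   that carries (or receives an isometry from) a probability space is nonempty. *)
#[short(type="pmetricType")]
HB.structure Definition PointedMetric (R : numDomainType) :=
  {T of Metric R T & isPointed T}.

#[short(type="completeMetricType")]
HB.structure Definition CompleteMetric (R : numDomainType) :=
  {T of Complete T & Metric R T}.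

Definition separable_space (T : topologicalType) :=
  exists2 D : set T, countable D & dense D.

Notation borel T := (g_sigma_algebraType (@open T)).

Record mmSpace (R : realType) := MMSpace {
  mm_carrier :> completeMetricType R;
  mm_separable : separable_space mm_carrier;
  mm_measure : probability (borel mm_carrier) R }.

Record isometric_embedding (R : realType) (X Y : metricType R) := IsometricEmbedding {
  isom_fun :> X -> Y;
  isomP : forall x y, mdist (isom_fun x) (isom_fun y) = mdist x y }.

Section isometry_theory.
Context (R : realType).

Lemma isometry_continuous (X Y : metricType R) (f : X -> Y) :
  (forall x y, mdist (f x) (f y) = mdist x y) -> continuous f.
Proof.
move=> fP x; apply/metricType_numDomainType.cvgrPdist_lt => e e0.
near=> t; rewrite fP; near: t.
have := nbhsx_ballx x _ e0; apply: filterS => y.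
by rewrite ballEmdist.
Unshelve. all: by end_near. Qed.

Lemma borel_continuous_measurable (X Y : ptopologicalType) (f : X -> Y) :
  continuous f -> measurable_fun setT (f : borel X -> borel Y).
Proof.
move=> cf; apply: (@measurability _ _ (borel X) (borel Y) setT f (@open Y)) => //.
move=> _ [B oB <-]; rewrite setTI; apply: sub_sigma_algebra.
by move/continuousP : cf; apply.
Qed.

Lemma isometry_measurable (X Y : pmetricType R) (f : isometric_embedding X Y) :
  measurable_fun setT (isom_fun f : borel X -> borel Y).
Proof.
exact: borel_continuous_measurable (isometry_continuous (isomP f)).
Qed.

Definition isom_mfun (X Y : pmetricType R) (f : isometric_embedding X Y) :
    {mfun borel X >-> borel Y} :=
  HB.pack (isom_fun f : borel X -> borel Y)
    (isMeasurableFun.Build _ _ _ _ _ (isometry_measurable f)).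

Definition image_law (X Y : pmetricType R) (mu : probability (borel X) R)
    (f : isometric_embedding X Y) : probability (borel Y) R :=
  distribution mu (isom_mfun f).
End isometry_theory.

(* A^e = {x | d(A, x) < e}; d(set0, x) = +oo, so the enlargement of set0 is set0. *)
Definition enlarge (R : realType) (X : metricType R) (A : set X) (e : R) :
    set X :=
  [set x | ereal_inf [set (mdist a x)%:E | a in A] < e%:E]%E.

Definition prohorov (R : realType) (X : pmetricType R)
    (mu nu : probability (borel X) R) : \bar R :=
  ereal_inf [set e%:E | e in [set e : R | 0 < e /\
    forall A : set (borel X), measurable A ->
      (mu A <= nu (enlarge A e) + e%:E)%E]].

Definition gromov_prohorov (R : realType) (X Y : mmSpace R) : \bar R :=
  ereal_inf [set r | exists (Z : pmetricType R)
      (f : isometric_embedding X Z) (g : isometric_embedding Y Z),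
    separable_space Z /\
    r = prohorov (image_law (mm_measure X) f) (image_law (mm_measure Y) g)].

Record pseudometric (R : numDomainType) (T : Type) := Pseudometric {
  psd :> T -> T -> R;
  psdxx : forall x, psd x x = 0;
  psd_sym : forall x y, psd x y = psd y x;
  psd_triangle : forall y x z, psd x z <= psd x y + psd y z }.

Section metric_quotient.
Context (R : realType) (T : pointedType) (d : pseudometric R T).

Lemma psd_ge0 x y : 0 <= d x y.
Proof.
have := psd_triangle d y x x; rewrite psdxx (psd_sym d y) -mulr2n.
by rewrite pmulrn_lge0.
Qed.

Definition zero_dist (x y : T) : bool := d x y == 0.

Lemma zero_dist_refl : reflexive zero_dist.
Proof. by move=> x; rewrite /zero_dist psdxx. Qed.

Lemma zero_dist_sym : symmetric zero_dist.
Proof. by move=> x y; rewrite /zero_dist psd_sym. Qed.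

Lemma zero_dist_trans : transitive zero_dist.
Proof.
move=> y x z /eqP xy /eqP yz; rewrite /zero_dist eq_le psd_ge0 andbT.
by rewrite (le_trans (psd_triangle d y _ _))// xy yz addr0.
Qed.

Canonical zero_dist_equiv :=
  EquivRel zero_dist zero_dist_refl zero_dist_sym zero_dist_trans.

Definition metric_quotient : Type := {eq_quot zero_dist_equiv}.

Definition metric_pi (x : T) : metric_quotient :=
  \pi_({eq_quot zero_dist_equiv}) x.

HB.instance Definition _ := Choice.copy metric_quotient {eq_quot zero_dist_equiv}.
HB.instance Definition _ := isPointed.Build metric_quotient (metric_pi point).

Definition quotient_dist (x y : metric_quotient) : R :=
  d (repr (x : {eq_quot zero_dist_equiv})) (repr (y : {eq_quot zero_dist_equiv})).

Lemma quotient_dist_pi (x y : T) :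
  quotient_dist (metric_pi x) (metric_pi y) = d x y.
Proof.
have reprE z : d (repr (\pi_({eq_quot zero_dist_equiv}) z)) z = 0.
  by apply/eqP; rewrite -[_ == 0]/(zero_dist_equiv _ _) -eqmodE reprK.
rewrite /quotient_dist /metric_pi; apply/eqP; rewrite eq_le; apply/andP; split.
  apply: le_trans (psd_triangle d x _ _) _; rewrite reprE add0r.
  apply: le_trans (psd_triangle d y _ _) _; rewrite (psd_sym d y) reprE.
  by rewrite addr0.
apply: le_trans (psd_triangle d (repr (\pi_({eq_quot zero_dist_equiv}) x)) _ _) _.
rewrite (psd_sym d x) reprE add0r.
apply: le_trans (psd_triangle d (repr (\pi_({eq_quot zero_dist_equiv}) y)) _ _) _.
by rewrite reprE addr0.
Qed.

Lemma metric_pi_surj (x : metric_quotient) : exists t, metric_pi t = x.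
Proof. by exists (repr (x : {eq_quot zero_dist_equiv})); rewrite /metric_pi reprK. Qed.

Lemma quotient_distxx x : quotient_dist x x = 0.
Proof. exact: psdxx. Qed.

Lemma quotient_dist_positivity x y : quotient_dist x y = 0 -> x = y.
Proof.
have [s <-] := metric_pi_surj x; have [t <-] := metric_pi_surj y.
rewrite quotient_dist_pi => /eqP st; by apply/eqP; rewrite /metric_pi eqmodE.
Qed.

Lemma quotient_dist_sym x y : quotient_dist x y = quotient_dist y x.
Proof. exact: psd_sym. Qed.

Lemma quotient_dist_triangle y x z :
  quotient_dist x z <= quotient_dist x y + quotient_dist y z.
Proof. exact: psd_triangle. Qed.

HB.instance Definition _ := isMetric.Build R metric_quotient quotient_distxx
  quotient_dist_positivity quotient_dist_sym quotient_dist_triangle.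

Lemma mdist_pi (x y : T) : mdist (metric_pi x) (metric_pi y) = d x y.
Proof. exact: quotient_dist_pi. Qed.

End metric_quotient.

Lemma dense_mdistP (R : realType) (X : metricType R) (D : set X) :
  dense D <-> forall x (e : R), 0 < e -> exists2 y, D y & mdist x y < e.
Proof.
split=> [dD x e e0|dD U [x Ux] oU].
  have xe : (ball x e)° !=set0.
    by exists x; apply: nbhs_singleton; apply: nbhs_interior; exact: nbhsx_ballx.
  have [y [/interior_subset]] := dD _ xe (@open_interior _ _).
  by rewrite ballEmdist /= => xy Dy; exists y.
have /nbhs_ballP[e /= e0 eU] : nbhs x U by exact: open_nbhs_nbhs.
have [y Dy xy] := dD x _ e0; exists y; split => //.
by apply: eU; rewrite ballEmdist.
Qed.

(* Completion by Cauchy sequences: the metric quotient of the space of Cauchy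
   sequences under the pseudometric lim_n d(u_n, v_n). *)
Section completion.
Context (R : realType) (X : pmetricType R).

Record cauchy_seq := CauchySeq {
  cauchy_fun :> nat -> X;
  cauchy_seqP : cauchy (cauchy_fun n @[n --> \oo]) }.
HB.instance Definition _ := gen_eqMixin cauchy_seq.
HB.instance Definition _ := gen_choiceMixin cauchy_seq.

Lemma cauchyE (u : nat -> X) : cauchy (u n @[n --> \oo]) <->
  forall e, 0 < e -> exists N, forall n m,
    (N <= n)%N -> (N <= m)%N -> mdist (u n) (u m) < e.
Proof.
rewrite -cauchy_ballP; split => [cu e e0|cu e e0].
  have [[A B] /= [[N _ NA] [M _ MB]] AB] := cu _ e0.
  exists (maxn N M) => n m; rewrite !geq_max => /andP[Nn _] /andP[_ Mm].
  have := AB (u n, u m); rewrite /= ballEmdist /=; apply; split.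
    exact: NA.
  exact: MB.
have [N uN] := cu _ e0.
exists (u @` [set n | (N <= n)%N], u @` [set n | (N <= n)%N]) => /=.
  by split; exists N => // n /= Nn; exists n.
by move=> [_ _] /= [[n Nn <-] [m Nm <-]]; rewrite ballEmdist /=; exact: uN.
Qed.

Lemma cst_cauchy (x : X) : cauchy (cst x n @[n --> \oo]).
Proof. by apply/cauchyE => e e0; exists 0%N => n m _ _; rewrite /cst mdistxx. Qed.

Definition cst_seq (x : X) : cauchy_seq := CauchySeq (cst_cauchy x).
HB.instance Definition _ := isPointed.Build cauchy_seq (cst_seq point).

Definition seq_dist (u v : cauchy_seq) : R :=
  limn (fun n => mdist (u n) (v n)).

Lemma seq_dist_cvg (u v : cauchy_seq) :
  mdist (u n) (v n) @[n --> \oo] --> seq_dist u v.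
Proof.
have /cauchyE cu := @cauchy_seqP u; have /cauchyE cv := @cauchy_seqP v.
apply: cauchy_cvg; apply/cauchy_ballP => e e0.
have e20 : 0 < e / 2 by rewrite divr_gt0.
have [N uN] := cu _ e20; have [M vM] := cv _ e20.
pose K := maxn N M.
exists ((fun n => mdist (u n) (v n)) @` [set n | (K <= n)%N],
        (fun n => mdist (u n) (v n)) @` [set n | (K <= n)%N]) => /=.
  by split; exists K => // n /= Kn; exists n.
move=> [_ _] /= [[n Kn <-] [m Km <-]].
move: Kn Km; rewrite !geq_max => /andP[Nn Mn] /andP[Nm Mm].
rewrite /ball /= [ltRHS]splitr ltr_norml; apply/andP; split.
  rewrite ltrBDr -ltrBDl opprK.
  have := metric_triangle (u m) (u n) (v m).
  have := metric_triangle (u n) (v n) (v m).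
  have := uN m n Nm Nn; have := vM n m Mn Mm; lra.
have := metric_triangle (u n) (u m) (v n).
have := metric_triangle (u m) (v m) (v n).
have := uN n m Nn Nm; have := vM m n Mm Mn; lra.
Qed.

Lemma seq_distxx u : seq_dist u u = 0.
Proof.
rewrite /seq_dist (_ : (fun n => mdist (u n) (u n)) = cst 0) ?lim_cst//.
by apply/funext => n; exact: mdistxx.
Qed.

Lemma seq_dist_sym u v : seq_dist u v = seq_dist v u.
Proof. by rewrite /seq_dist; under eq_fun do rewrite metric_sym. Qed.

Lemma seq_dist_triangle v u w : seq_dist u w <= seq_dist u v + seq_dist v w.
Proof.
apply: (ler_cvg_to (@seq_dist_cvg u w)
  (cvgD (@seq_dist_cvg u v) (@seq_dist_cvg v w))).
by apply: nearW => n; exact: metric_triangle.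
Qed.

Definition seq_pseudometric : pseudometric R cauchy_seq :=
  Pseudometric seq_distxx seq_dist_sym seq_dist_triangle.

Definition completion : Type := metric_quotient seq_pseudometric.
HB.instance Definition _ := PointedMetric.on completion.

Definition to_completion (x : X) : completion :=
  metric_pi seq_pseudometric (cst_seq x).

Lemma to_completion_isometry x y :
  mdist (to_completion x) (to_completion y) = mdist x y.
Proof.
rewrite mdist_pi; change (limn (fun=> mdist x y) = mdist x y).
exact: lim_cst.
Qed.

Lemma to_completion_le (u : cauchy_seq) (y : X) (e : R) (N : nat) :
  (forall n, (N <= n)%N -> mdist (u n) y <= e) ->
  mdist (metric_pi seq_pseudometric u : completion) (to_completion y) <= e.
Proof.
move=> uy; rewrite mdist_pi.
apply: (ler_cvg_to (@seq_dist_cvg u (cst_seq y)) (cvg_cst e)).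
by exists N => // n /= /uy.
Qed.

Lemma to_completion_approx (x : completion) (e : R) : 0 < e ->
  exists y, mdist x (to_completion y) < e.
Proof.
move=> e0; have [u <-] := metric_pi_surj x.
have e20 : 0 < e / 2 by rewrite divr_gt0.
have /cauchyE/(_ _ e20)[N uN] := @cauchy_seqP u.
exists (u N); apply: (@le_lt_trans _ _ (e / 2)); last by lra.
by apply: (@to_completion_le u _ _ N) => n Nn; apply/ltW/uN.
Qed.

Lemma completion_complete (F : set_system completion) :
  ProperFilter F -> cauchy F -> cvg F.
Proof.
move=> PF /cauchyP cF.
have [r r0 small] : exists2 r : nat -> R, (forall n, 0 < r n) &
    forall e, 0 < e -> exists N, forall n, (N <= n)%N -> r n < e.
  exists (fun n => n.+1%:R^-1) => [n|e e0]; first by rewrite invr_gt0.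
  have [N] := ltr_add_invr e0; rewrite add0r => Ne; exists N => n Nn.
  by apply: le_lt_trans Ne; rewrite lef_pV2 ?posrE// ler_nat.
have approx n : exists y, F (ball (to_completion y) (2 * r n)).
  have [x Fx] := cF _ (r0 n); have [y xy] := to_completion_approx x (r0 n).
  exists y; apply: filterS Fx => z; rewrite !ballEmdist /= => xz.
  apply: le_lt_trans (metric_triangle _ x _) _.
  by rewrite metric_sym mulr2n mulrDl !mul1r ltrD.
have [y Fy] := choice approx.
have yy n m : mdist (y n) (y m) < 2 * r n + 2 * r m.
  have [z []] := filter_ex (filterI (Fy n) (Fy m)).
  rewrite !ballEmdist /= => nz mz; rewrite -to_completion_isometry.
  apply: le_lt_trans (metric_triangle _ z _) _.
  by rewrite [X in _ + X]metric_sym ltrD.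
have cy : cauchy (y n @[n --> \oo]).
  apply/cauchyE => e e0; have e40 : 0 < e / 4 by rewrite divr_gt0.
  have [N Ne] := small _ e40; exists N => n m /Ne Nn /Ne Nm.
  by have := yy n m; lra.
apply/cvg_ex; exists (metric_pi seq_pseudometric (CauchySeq cy)).
move=> A /nbhs_ballP[e /= e0 eA].
have e80 : 0 < e / 8 by rewrite divr_gt0.
have [N Ne] := small _ e80.
apply: filterS (Fy N) => z; rewrite ballEmdist /= => yz.
apply: eA; rewrite ballEmdist /=.
apply: le_lt_trans (metric_triangle _ (to_completion (y N)) _) _.
have : mdist (metric_pi seq_pseudometric (CauchySeq cy) : completion)
    (to_completion (y N)) <= e / 2.
  apply: (@to_completion_le _ _ _ N) => n Nn /=.
  by have := yy n N; have := Ne n Nn; have := Ne N (leqnn N); lra.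
by have := Ne N (leqnn N); lra.
Qed.

HB.instance Definition _ := Uniform_isComplete.Build completion completion_complete.

Lemma completion_separable : separable_space X -> separable_space completion.
Proof.
move=> [D cD /dense_mdistP dD]; exists (to_completion @` D).
  exact: (sub_countable (card_image_le _ _)).
apply/dense_mdistP => x e e0.
have e20 : 0 < e / 2 by rewrite divr_gt0.
have [y xy] := to_completion_approx x e20; have [z Dz yz] := dD y _ e20.
exists (to_completion z); first by exists z.
apply: le_lt_trans (metric_triangle _ (to_completion y) _) _.
by rewrite [ltRHS]splitr to_completion_isometry ltrD.
Qed.

End completion.

Section unit_interval.
Context (R : realType).

Definition unitI : Type := `[0%R, 1%R]%classic : set R.
HB.instance Definition _ := Topological.copy unitI (`[0%R, 1%R]%classic : set R).

Lemma in_unitI (x : R) : 0 <= x <= 1 -> x \in `[0, 1]%classic.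
Proof. by move=> x01; rewrite inE/= in_itv. Qed.

Definition unitI0 : unitI := exist _ 0 (in_unitI (introT andP (conj (lexx 0) ler01))).
HB.instance Definition _ := isPointed.Build unitI unitI0.

Definition lebesgue_unitI (A : set (borel unitI)) : \bar R :=
  lebesgue_measure [set val t | t in (A : set unitI)].

Lemma measurable_val (A : set (borel unitI)) : measurable A ->
  measurable [set val t | t in (A : set unitI)].
Proof.
move: A; apply: smallest_sub; last first.
  move=> _ [B oB <-].
  rewrite (_ : [set _ | _ in _] = `[0, 1]%classic `&` B).
    by apply: measurableI => //; exact: measurable_realfun.open_measurable.
  apply/seteqP; split=> [_ [t Bt <-]|x [x01 Bx]].
    by split => //; exact: set_valP.
  by exists (exist _ x (mem_set x01)).
split=> [|A mA|F mF]; first by rewrite image_set0.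
  rewrite (_ : [set _ | _ in _] = `[0, 1]%classic `\` [set val t | t in A]).
    exact: measurableD.
  apply/seteqP; split=> [_ [t [_ At] <-]|x [x01 Ax]].
    by split; [exact: set_valP|move=> [u Au /val_inj ut]; apply: At; rewrite -ut].
  exists (exist _ x (mem_set x01)) => //; split => // At; apply: Ax.
  by exists (exist _ x (mem_set x01)).
by rewrite image_bigcup; exact: bigcupT_measurable.
Qed.

Lemma lebesgue_unitI0 : lebesgue_unitI set0 = 0%E.
Proof. by rewrite /lebesgue_unitI image_set0 measure0. Qed.

Lemma lebesgue_unitI_ge0 A : (0 <= lebesgue_unitI A)%E.
Proof. exact: measure_ge0. Qed.

Lemma lebesgue_unitI_sigma_additive : semi_sigma_additive lebesgue_unitI.
Proof.
move=> F mF tF mUF; rewrite /lebesgue_unitI image_bigcup.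
apply: (@measure_semi_sigma_additive _ _ _ lebesgue_measure
  (fun n => [set val t | t in (F n : set unitI)])).
- by move=> n; exact: measurable_val.
- move=> i j _ _ [_ [[t Ft <-] [u Fu /val_inj ut]]].
  by apply: tF => //; exists t; split => //; rewrite -ut.
- by rewrite -image_bigcup; exact: measurable_val.
Qed.

HB.instance Definition _ := isMeasure.Build _ _ _ lebesgue_unitI
  lebesgue_unitI0 lebesgue_unitI_ge0 lebesgue_unitI_sigma_additive.

Lemma lebesgue_unitI_setT : lebesgue_unitI setT = 1%E.
Proof.
rewrite /lebesgue_unitI (_ : [set _ | _ in _] = `[0, 1]%classic).
  by rewrite lebesgue_measure_itv /= lte_fin ltr01 sube0.
apply/seteqP; split=> [_ [t _ <-]|x x01]; first exact: set_valP.
by exists (exist _ x (mem_set x01)).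
Qed.

HB.instance Definition _ :=
  Measure_isProbability.Build _ _ _ lebesgue_unitI lebesgue_unitI_setT.

End unit_interval.

Record excursion (R : realType) := Excursion {
  exc_fun :> unitI R -> R;
  exc_ge0 : forall t, 0 <= exc_fun t;
  exc_init : exc_fun (unitI0 R) = 0;
  exc_lsc : lower_semicontinuous (fun t => (exc_fun t)%:E) }.

Lemma between_wider (R : realDomainType) (a b c v : R) :
  a <= b <= c \/ c <= b <= a ->
  Num.min a b <= v <= Num.max a b -> Num.min a c <= v <= Num.max a c.
Proof.
by rewrite !ge_min !le_max => -[] /andP[ab bc] /andP[/orP[] av /orP[] va];
  apply/andP; split; apply/orP; by [left; lra|right; lra].
Qed.

Section coding.
Context (R : realType).
Implicit Types (h g : excursion R) (s t : unitI R).

(* I_h(s, t) *)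
Definition running_inf h s t : R :=
  inf [set h u | u in [set u : unitI R |
    Num.min (val s) (val t) <= val u <= Num.max (val s) (val t)]].

Definition exc_dist h s t : R := h s + h t - 2 * running_inf h s t.

Lemma running_inf_le h s t u :
  Num.min (val s) (val t) <= val u <= Num.max (val s) (val t) ->
  running_inf h s t <= h u.
Proof.
move=> stu; apply: ge_inf; last by exists u.
by exists 0 => _ [v _ <-]; exact: exc_ge0.
Qed.

Lemma le_running_inf h s t c :
  (forall u : unitI R, Num.min (val s) (val t) <= val u <= Num.max (val s) (val t) ->
    c <= h u) ->
  c <= running_inf h s t.
Proof.
move=> ch; apply: lb_le_inf; last by move=> _ [u stu <-]; exact: ch.
exists (h s), s => //=.
by rewrite ge_min le_max lexx.
Qed.

Lemma exc_distxx h s : exc_dist h s s = 0.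
Proof.
rewrite /exc_dist; suff -> : running_inf h s s = h s by ring.
apply/eqP; rewrite eq_le running_inf_le ?minxx ?maxxx ?lexx//=.
apply: le_running_inf => u; rewrite minxx maxxx => /le_anti.
by move/val_inj => ->.
Qed.

Lemma exc_dist_sym h s t : exc_dist h s t = exc_dist h t s.
Proof. by rewrite /exc_dist /running_inf minC maxC (addrC (h s)). Qed.

Lemma exc_dist_triangle h t s u :
  exc_dist h s u <= exc_dist h s t + exc_dist h t u.
Proof.
suff : Num.min (running_inf h s t) (running_inf h t u) <= running_inf h s u.
  have : running_inf h s t <= h t.
    by apply: running_inf_le; rewrite ge_min le_max lexx !orbT.
  have : running_inf h t u <= h t.
    by apply: running_inf_le; rewrite ge_min le_max lexx.
  rewrite /exc_dist ge_min => ? ? /orP[]; lra.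
apply: le_running_inf => v; rewrite ge_min le_max => /andP[suv vsu].
rewrite ge_min; apply/orP.
have [vst|vst] := boolP (Num.min (val s) (val t) <= val v <= Num.max (val s) (val t)).
  by left; exact: running_inf_le.
right; apply: running_inf_le.
by move: suv vsu vst; rewrite !ge_min !le_max; case: (leP (val t) (val v));
  case: (leP (val v) (val t)); case: (leP (val s) (val v)); case: (leP (val v) (val s));
  case: (leP (val u) (val v)); case: (leP (val v) (val u)) => //=; lra.
Qed.

Definition exc_pseudometric h : pseudometric R (unitI R) :=
  Pseudometric (exc_distxx h) (exc_dist_sym h) (exc_dist_triangle h).

Definition coded_quotient h : Type := metric_quotient (exc_pseudometric h).
HB.instance Definition _ h := PointedMetric.on (coded_quotient h).

(* T_h, identified with its completion; coding_pi below is the projection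
   [0, 1] -> [0, 1] / d_h followed by the embedding into the completion. *)
Definition coded_tree h : Type := completion (coded_quotient h).
HB.instance Definition _ h := CompleteMetric.on (coded_tree h).

Definition coding_pi h (t : unitI R) : coded_tree h :=
  to_completion (metric_pi (exc_pseudometric h) t : coded_quotient h).

Lemma exc_dist_countable_dense h : exists D : rat * rat * nat -> unitI R,
  forall s (e : R), 0 < e -> exists i, exc_dist h (D i) s < e.
Proof.
pose P (i : rat * rat * nat) : set (unitI R) := [set t : unitI R |
  ((ratr i.1.1 : R) < val t < ratr i.1.2) /\
  forall u : unitI R, ((ratr i.1.1 : R) < val u < ratr i.1.2) ->
    h t <= h u + i.2.+1%:R^-1].
exists (fun i => get (P i)) => s e e0; have e80 : 0 < e / 8 by rewrite divr_gt0.
have [V sV hV] : exists2 V, nbhs s V & forall y, V y -> h s - e / 8 < h y.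
  have [|V sV hV] := @exc_lsc _ h s (h s - e / 8).
    by rewrite lte_fin ltrBlDr ltrDl.
  by exists V => // y /hV; rewrite lte_fin.
have [a [b [asb abV]]] : exists a b : rat, ((ratr a : R) < val s < ratr b) /\
    forall y : unitI R, ((ratr a : R) < val y < ratr b) -> V y.
  move: sV; rewrite nbhsE => -[_ [[W oW <-] Ws] WV].
  have /nbhs_ballP[d /= d0 dW] : nbhs (val s : R) W by exact: open_nbhs_nbhs.
  have /rat_in_itvoo[a] : val s - d < val s by rewrite ltrBlDr ltrDl.
  rewrite in_itv/= => /andP[da sa].
  have /rat_in_itvoo[b] : val s < val s + d by rewrite ltrDl.
  rewrite in_itv/= => /andP[sb bd].
  exists a, b; rewrite sa sb; split => // y /andP[ay yb].
  apply: WV; apply: dW; change (`|val s - val y| < d); rewrite distrC ltr_distl.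
  have dy := lt_trans da ay; have yd := lt_trans yb bd.
  by rewrite dy yd.
have [n] := ltr_add_invr e80; rewrite add0r => ne.
pose I : set R := [set h u | u in [set u : unitI R | ratr a < val u < ratr b]].
have infI : has_inf I.
  split; first by exists (h s), s.
  by exists 0 => _ [v _ <-]; exact: exc_ge0.
have Pabn : P (a, b, n) (get (P (a, b, n))).
  have n0 : 0 < n.+1%:R^-1 :> R by rewrite invr_gt0.
  have [_ [t tab <-] tI] := inf_adherent n0 infI.
  apply: (@getI _ _ t); split => //= u uab.
  apply: ltW; apply: lt_le_trans tI _; rewrite lerD2r.
  by apply: ge_inf; [case: infI|exists u].
exists (a, b, n); set t := get (P (a, b, n)) in Pabn *.
case: Pabn => /= /andP[at_ tb] /(_ s asb) hts.
have {asb}[as_ sb] := andP asb.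
have : h s - e / 8 <= running_inf h t s.
  apply: le_running_inf => u; rewrite ge_min le_max => /andP[tsu uts].
  apply/ltW/hV/abV; apply/andP; split.
    by case/orP : tsu => [|] /(lt_le_trans _); apply.
  by case/orP : uts => [|] /le_lt_trans; apply.
move: ne hts; rewrite /exc_dist; set r := n.+1%:R^-1; lra.
Qed.

Lemma coded_quotient_separable h : separable_space (coded_quotient h).
Proof.
have [D dD] := exc_dist_countable_dense h.
exists (range (metric_pi (exc_pseudometric h) \o D)).
  exact: (sub_countable (card_image_le _ _)).
apply/dense_mdistP => x e e0; have [s <-] := metric_pi_surj x.
have [i is_] := dD s _ e0; exists (metric_pi (exc_pseudometric h) (D i)).
  by exists i.
by rewrite metric_sym mdist_pi.
Qed.

Lemma coded_tree_separable h : separable_space (coded_tree h).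
Proof. exact: completion_separable (coded_quotient_separable h). Qed.

Lemma mdist_coding_pi h s t :
  mdist (coding_pi h s) (coding_pi h t) = exc_dist h s t.
Proof. by rewrite to_completion_isometry mdist_pi. Qed.

Lemma measurable_convex_unitI (A : set (unitI R)) :
  (forall s t u, A s -> A t -> val s <= val u <= val t -> A u) ->
  measurable (A : set (borel (unitI R))).
Proof.
move=> cA.
pose B : set R := [set x | exists s t, [/\ A s, A t & val s <= x <= val t]].
have mB : measurable B.
  apply: is_interval_measurable => x y [s [_ [As _ /andP[sx _]]]].
  move=> [_ [t [_ At /andP[_ yt]]]] z /andP[xz zy]; exists s, t; split => //.
  by rewrite (le_trans sx)//= (le_trans zy).
have mval : measurable_fun setT (val : borel (unitI R) -> R).
  apply: (measurability _ (RGenOpens.measurableE R)).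
  move=> _ [_ [a [b ->]] <-]; rewrite setTI; apply: sub_sigma_algebra.
  by exists `]a, b[%classic => //; exact: interval_open.
rewrite (_ : A = setT `&` (val : borel (unitI R) -> R) @^-1` B); first exact: mval.
rewrite setTI; apply/seteqP; split=> [s As|s [t [u [At Au tsu]]]].
  by exists s, s; rewrite lexx.
exact: cA At Au tsu.
Qed.

Lemma measurable_exc_dist h t :
  measurable_fun setT (exc_dist h t : borel (unitI R) -> R).
Proof.
have mh : measurable_fun setT (h : borel (unitI R) -> R).
  apply: (measurability _ (RGenOInfty.measurableE R)).
  move=> _ [_ [a ->] <-]; rewrite setTI; apply: sub_sigma_algebra.
  have /lower_semicontinuousP/(_ a) := @exc_lsc _ h.
  congr open; apply/seteqP; split=> s /=; rewrite in_itv/= andbT lte_fin//.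
have mI : measurable_fun setT (running_inf h t : borel (unitI R) -> R).
  apply: (measurability _ (RGenCInfty.measurableE R)).
  move=> _ [_ [a ->] <-]; rewrite setTI.
  apply: measurable_convex_unitI => s1 s2 s /=; rewrite !in_itv/= !andbT.
  move=> as1 as2 /andP[s1s ss2]; apply: le_running_inf => u.
  move=> tsu; have [ts|/ltW st] := leP (val t) (val s).
    apply: le_trans as2 _; apply: running_inf_le; apply: between_wider tsu.
    by left; apply/andP.
  apply: le_trans as1 _; apply: running_inf_le; apply: between_wider tsu.
  by right; apply/andP.
apply: measurable_funB; first exact: measurable_funD.
exact: measurable_funM.
Qed.

Lemma coding_pi_measurable h :
  measurable_fun setT (coding_pi h : borel (unitI R) -> borel (coded_tree h)).
Proof.
have [D dD] := exc_dist_countable_dense h.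
apply: (@measurability _ _ (borel (unitI R)) (borel (coded_tree h)) setT (coding_pi h)
  (@open (coded_tree h))) => //.
move=> _ [U oU <-]; rewrite setTI.
pose B (i : (rat * rat * nat) * nat) : set (borel (unitI R)) :=
  [set s | exc_dist h (D i.1) s < i.2.+1%:R^-1].
pose C i := if pselect (B i `<=` coding_pi h @^-1` U) then B i else set0.
rewrite (_ : _ @^-1` _ = \bigcup_i C i).
  apply: countable_bigcupT_measurable => // -[j n].
  rewrite /C; case: pselect => //= _; rewrite -[X in measurable X]setTI.
  rewrite (_ : B _ = exc_dist h (D j) @^-1` `]-oo, n.+1%:R^-1[%classic).
    exact: measurable_exc_dist.
  by apply/seteqP; split=> s /=; rewrite in_itv.
apply/seteqP; split=> [s /= Us|s [i _]]; last first.
  by rewrite /C; case: pselect => //= + Bs; exact.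
have /nbhs_ballP[e /= e0 eU] : nbhs (coding_pi h s) U by exact: open_nbhs_nbhs.
have e20 : 0 < e / 2 by rewrite divr_gt0.
have [n] := ltr_add_invr e20; rewrite add0r => ne.
have n0 : 0 < n.+1%:R^-1 :> R by rewrite invr_gt0.
have [j js] := dD s _ n0.
exists (j, n) => //; rewrite /C; case: pselect => //= -[].
move=> u /= ju; apply: eU.
rewrite ballEmdist /= mdist_coding_pi.
apply: le_lt_trans (exc_dist_triangle h (D j) _ _) _.
move: js ju ne; rewrite (exc_dist_sym h s) /B /=; set r := n.+1%:R^-1; lra.
Qed.

Definition coding_mfun h : {mfun borel (unitI R) >-> borel (coded_tree h)} :=
  HB.pack (coding_pi h : borel (unitI R) -> borel (coded_tree h))
    (isMeasurableFun.Build _ _ _ _ _ (@coding_pi_measurable h)).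

Definition coded_law h : probability (borel (coded_tree h)) R :=
  distribution (@lebesgue_unitI R) (coding_mfun h).

Definition coded_mmSpace h : mmSpace R :=
  MMSpace (coded_tree_separable h) (coded_law h).

End coding.

(* Extended-real valued: excursions are only lower semicontinuous, so they may
   be unbounded. *)
Definition sup_norm (R : realType) (f : unitI R -> R) : \bar R :=
  ereal_sup [set `|f t|%:E | t in [set: unitI R]].

(* Main.v *)
Require Import Defs.
From HB Require Import structures.
From mathcomp Require Import all_boot all_order all_algebra.
From mathcomp Require Import all_classical all_reals all_analysis.
From mathcomp Require Import lra.
Set Implicit Arguments.
Unset Strict Implicit.
Unset Printing Implicit Defensive.
Local Open Scope ereal_scope.

Import Order.TTheory GRing.Theory Num.Theory.

(** Both coded spaces are images of the same probability space, [0, 1] with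
    Lebesgue measure, under the projections [pi_h] and [pi_g]. Write [D] for the
    uniform distance of [h] and [g]. Moving an excursion by at most [D] moves
    [h s], [h t] and the infimum [I_h(s, t)] by at most [D] each, hence changes
    [d_h(s, t) = h s + h t - 2 I_h(s, t)] by at most [4 D]
    ([exc_dist_distortion]).

    A correspondence of distortion at most [2 r] allows the two spaces to be
    glued isometrically so that corresponding points lie within distance [r]:
    a path from one space to the other pays [r] for crossing at a
    corresponding pair, and a path that crosses back pays [2 r] in total,
    exactly what makes up for the distortion, so it creates no shortcut
    ([mdist_le_cross_l], [mdist_le_cross_r]). With [r = 2 D], the points
    [pi_h t] and [pi_g t] are at distance at most [2 D] in the glued space for
    every [t]. So the two image laws have a coupling supported on pairs at
    distance at most [2 D], which bounds their Prohorov distance by [2 D]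
    ([prohorov_coupling]). The last two steps apply to any two mm-spaces
    parametrised by a common probability space
    ([gromov_prohorov_parametrised]). *)

Section coded_distance_stability.
Local Open Scope ring_scope.
Context (R : realType).
Implicit Types (h g : excursion R) (s t : unitI R).

Lemma running_inf_le_shift h g (r : R) s t :
  (forall u, h u <= g u + r) -> running_inf h s t <= running_inf g s t + r.
Proof.
move=> hg; rewrite -lerBlDr; apply: le_running_inf => u stu.
by rewrite lerBlDr (le_trans (running_inf_le h stu)).
Qed.

(** Each of [h s] and [h t] contributes [r], and the infimum, which is counted
    twice, contributes [2 r]. Exchanging [h] and [g] gives the other bound. *)
Lemma exc_dist_distortion h g (r : R) s t :
  (forall u, `|h u - g u| <= r) -> exc_dist h s t <= exc_dist g s t + 4 * r.
Proof.
move=> hgr.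
have gh : running_inf g s t <= running_inf h s t + r.
  apply: running_inf_le_shift => u.
  by have := hgr u; rewrite ler_norml => /andP[]; lra.
have := hgr s; have := hgr t; rewrite /exc_dist !ler_norml.
by move=> /andP[_ ht] /andP[_ hs]; lra.
Qed.

End coded_distance_stability.

Section gluing.
Local Open Scope classical_set_scope.
Local Open Scope ring_scope.
Context (R : realType) (I : pointedType) (X Y : pmetricType R).
Context (a : I -> X) (b : I -> Y) (r : R).
Hypothesis distortion_l : forall i j,
  mdist (a i) (a j) <= mdist (b i) (b j) + 2 * r.
Hypothesis distortion_r : forall i j,
  mdist (b i) (b j) <= mdist (a i) (a j) + 2 * r.

(** The length of the shortest path from [X] to [Y] when each [a i] is joined to
    [b i] by a segment of length [r]. *)
Definition cross_dist (x : X) (y : Y) : R :=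
  inf [set mdist x (a i) + r + mdist (b i) y | i in [set: I]].

(** A correspondence cannot have negative distortion: compare a pair of indices
    with itself. This bounds the crossing lengths below, so that their infimum
    is meaningful. *)
Lemma glue_radius_ge0 : 0 <= r.
Proof. by have := distortion_l point point; rewrite !mdistxx; lra. Qed.

Lemma cross_dist_le x y i : cross_dist x y <= mdist x (a i) + r + mdist (b i) y.
Proof.
apply: ge_inf; last by exists i.
exists 0 => _ [j _ <-]; have := glue_radius_ge0.
by have := mdist_ge0 x (a j); have := mdist_ge0 (b j) y; lra.
Qed.

Lemma le_cross_dist x y c :
  (forall i, c <= mdist x (a i) + r + mdist (b i) y) -> c <= cross_dist x y.
Proof.
move=> cxy; apply: lb_le_inf => [|_ [i _ <-]]; last exact: cxy.
by exists (mdist x (a point) + r + mdist (b point) y), point.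
Qed.

Lemma cross_dist_triangle_l x' x y :
  cross_dist x y <= mdist x x' + cross_dist x' y.
Proof.
rewrite -lerBlDl; apply: le_cross_dist => i.
by have := cross_dist_le x y i; have := metric_triangle x x' (a i); lra.
Qed.

Lemma cross_dist_triangle_r y' x y :
  cross_dist x y <= cross_dist x y' + mdist y' y.
Proof.
rewrite -lerBlDr; apply: le_cross_dist => i.
by have := cross_dist_le x y i; have := metric_triangle (b i) y' y; lra.
Qed.

(** Crossing to [Y] at [i] and back at [j] is no shortcut: the part of the path
    inside [Y] has length at least [d(b i, b j)], and with the toll [2 r] for the
    two crossings this is at least [d(a i, a j)]. *)
Lemma mdist_le_cross_l x x' y : mdist x x' <= cross_dist x y + cross_dist x' y.
Proof.
rewrite -lerBlDr; apply: le_cross_dist => i.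
rewrite lerBlDr -lerBlDl; apply: le_cross_dist => j.
have := metric_triangle x (a i) x'; have := metric_triangle (a i) (a j) x'.
have := metric_triangle (b i) y (b j); have := distortion_l i j.
by rewrite (metric_sym x' (a j)) (metric_sym (b j) y); lra.
Qed.

(** The counterpart of [mdist_le_cross_l] for a path that leaves [Y] and returns
    to it. *)
Lemma mdist_le_cross_r x y y' : mdist y y' <= cross_dist x y + cross_dist x y'.
Proof.
rewrite -lerBlDr; apply: le_cross_dist => i.
rewrite lerBlDr -lerBlDl; apply: le_cross_dist => j.
have := metric_triangle y (b i) y'; have := metric_triangle (b i) (b j) y'.
have := metric_triangle (a i) x (a j); have := distortion_r i j.
by rewrite (metric_sym x (a i)) (metric_sym (b i) y); lra.
Qed.

Definition glue_sum : Type := (X + Y)%type.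
HB.instance Definition _ := Choice.on glue_sum.
HB.instance Definition _ := isPointed.Build glue_sum (inl point).

Definition glue_dist (p q : glue_sum) : R :=
  match p, q with
  | inl x, inl x' => mdist x x'
  | inl x, inr y => cross_dist x y
  | inr y, inl x => cross_dist x y
  | inr y, inr y' => mdist y y'
  end.

Lemma glue_distxx p : glue_dist p p = 0.
Proof. by case: p => z; exact: mdistxx. Qed.

Lemma glue_dist_sym p q : glue_dist p q = glue_dist q p.
Proof. by case: p q => [x|y] [x'|y'] //=; exact: metric_sym. Qed.

Lemma glue_dist_triangle q p s : glue_dist p s <= glue_dist p q + glue_dist q s.
Proof.
case: p q s => [x|y] [x'|y'] [x''|y''] /=.
- exact: metric_triangle.
- exact: cross_dist_triangle_l.
- exact: mdist_le_cross_l.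
- exact: cross_dist_triangle_r.
- by rewrite metric_sym addrC; exact: cross_dist_triangle_l.
- exact: mdist_le_cross_r.
- by rewrite metric_sym addrC; exact: cross_dist_triangle_r.
- exact: metric_triangle.
Qed.

Definition glue_pseudometric : pseudometric R glue_sum :=
  Pseudometric glue_distxx glue_dist_sym glue_dist_triangle.

(** For [r = 0] corresponding points are at distance zero, so the disjoint union
    carries only a pseudometric and a quotient has to be taken. *)
Definition glued : pmetricType R := metric_quotient glue_pseudometric.

Definition glue_inl : isometric_embedding X glued :=
  @IsometricEmbedding R X glued (fun x => metric_pi glue_pseudometric (inl x))
    (fun x x' => mdist_pi glue_pseudometric (inl x) (inl x')).

Definition glue_inr : isometric_embedding Y glued :=
  @IsometricEmbedding R Y glued (fun y => metric_pi glue_pseudometric (inr y))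
    (fun y y' => mdist_pi glue_pseudometric (inr y) (inr y')).

Lemma mdist_glued_le i : mdist (glue_inl (a i)) (glue_inr (b i)) <= r.
Proof.
rewrite mdist_pi /=; apply: le_trans (cross_dist_le _ _ i) _.
by rewrite !mdistxx add0r addr0.
Qed.

Lemma glued_separable :
  separable_space X -> separable_space Y -> separable_space glued.
Proof.
move=> [D cD /dense_mdistP dD] [E cE /dense_mdistP dE].
exists (glue_inl @` D `|` glue_inr @` E).
  rewrite -bigcup2E; apply: bigcup_countable => // -[|[|n]] _ /=.
  - exact: (sub_countable (card_image_le _ _)).
  - exact: (sub_countable (card_image_le _ _)).
  - exact: countable0.
apply/dense_mdistP => z e e0; have [[x|y] <-] := metric_pi_surj z.
  have [x' Dx' xx'] := dD x _ e0; exists (glue_inl x'); first by left; exists x'.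
  by rewrite (isomP glue_inl x x').
have [y' Ey' yy'] := dE y _ e0; exists (glue_inr y'); first by right; exists y'.
by rewrite (isomP glue_inr y y').
Qed.

End gluing.

Section coupling.
Local Open Scope classical_set_scope.
Context (R : realType).

(** Provides the measurability of enlargements, without which the monotonicity
    of a measure could not be applied to them. *)
Lemma enlarge_open (Z : metricType R) (A : set Z) (e : R) : open (enlarge A e).
Proof.
rewrite openE => z /ereal_inf_lt[_ [x Ax <-]]; rewrite lte_fin => xze.
apply/nbhs_ballP; exists (e - mdist x z)%R => /=; first by rewrite subr_gt0.
move=> w; rewrite ballEmdist /= => zw.
apply: (@le_lt_trans _ _ (mdist x w)%:E).
  by apply: ereal_inf_lbound; exists x.
rewrite lte_fin (le_lt_trans (metric_triangle x z w))//.
by rewrite -ltrBDl.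
Qed.

(** If [f t] lies in [A], then [g t] lies in the [(r + e)]-enlargement of [A], for
    every [e > 0]. The slack [e] accounts for the strict inequality in the
    enlargement and makes the radius positive. *)
Lemma prohorov_coupling (d : measure_display) (T : measurableType d)
    (P : probability T R) (Z : pmetricType R)
    (mu nu : probability (borel Z) R) (f g : {mfun T >-> borel Z}) (r : R) :
  (forall A, measurable A -> mu A = P (f @^-1` A)) ->
  (forall A, measurable A -> nu A = P (g @^-1` A)) ->
  (forall t, mdist (f t : Z) (g t) <= r)%R ->
  prohorov mu nu <= r%:E.
Proof.
move=> muE nuE fg; apply/lee_addgt0Pr => e e0; rewrite -EFinD.
have r0 : (0 <= r)%R by exact: le_trans (mdist_ge0 _ _) (fg point).
apply: ereal_inf_lbound; exists (r + e)%R => //; split; first by rewrite ltr_wpDl.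
move=> A mA; have mAe : measurable (enlarge A (r + e) : set (borel Z)).
  by apply: sub_sigma_algebra; exact: enlarge_open.
rewrite muE// nuE//; apply: (@le_trans _ _ (P (g @^-1` enlarge A (r + e)))).
  apply: le_measure; rewrite ?inE; [exact: measurable_sfunP..|].
  move=> t At; apply: (@le_lt_trans _ _ (mdist (f t : Z) (g t))%:E).
    by apply: ereal_inf_lbound; exists (f t).
  by rewrite lte_fin (le_lt_trans (fg t))// ltrDl.
by rewrite leeDl// lee_fin addr_ge0// ltW.
Qed.

(** The parametrisations serve twice: their common index set is the
    correspondence along which the spaces are glued, and the joint law of [a] and
    [b] is the coupling of the two image laws. *)
Lemma gromov_prohorov_parametrised (d : measure_display) (T : measurableType d)
    (P : probability T R) (X Y : mmSpace R)
    (a : {mfun T >-> borel X}) (b : {mfun T >-> borel Y}) (r : R) :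
  (forall A, mm_measure X A = P (a @^-1` A)) ->
  (forall A, mm_measure Y A = P (b @^-1` A)) ->
  (forall s t, mdist (a s : X) (a t) <= mdist (b s : Y) (b t) + 2 * r)%R ->
  (forall s t, mdist (b s : Y) (b t) <= mdist (a s : X) (a t) + 2 * r)%R ->
  gromov_prohorov X Y <= r%:E.
Proof.
move=> muX muY ab ba.
pose f := @glue_inl R T X Y a b r ab ba.
pose g := @glue_inr R T X Y a b r ab ba.
apply: (@le_trans _ _ (prohorov (image_law (mm_measure X) f)
                                (image_law (mm_measure Y) g))).
  apply: ereal_inf_lbound; exists (glued ab ba), f, g; split => //.
  by apply: glued_separable; exact: mm_separable.
apply: (@prohorov_coupling _ _ P _ _ _ (isom_mfun f \o a) (isom_mfun g \o b)).
- by move=> A _; exact: muX.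
- by move=> A _; exact: muY.
- by move=> t; exact: mdist_glued_le.
Qed.

End coupling.

Theorem proposition4p3 (R : realType) (h g : excursion R) :
  gromov_prohorov (coded_mmSpace h) (coded_mmSpace g)
    <= 2%:E * sup_norm (fun t => (h t - g t)%R).
Proof.
have sup_ub t : `|h t - g t|%:E <= sup_norm (fun t => (h t - g t)%R).
  by apply: ereal_sup_ubound; exists t.
case: (sup_norm _) sup_ub => [r| |] hgr.
(* The excursions need not be bounded, so the supremum may be infinite. *)
- have hg t : (`|h t - g t| <= r)%R by rewrite -lee_fin.
  have gh t : (`|g t - h t| <= r)%R by rewrite distrC.
  (* With gluing radius [2 r], the allowed distortion is [2 * (2 * r) = 4 * r]. *)
  rewrite -EFinM; apply: (@gromov_prohorov_parametrised R _ _
    (@lebesgue_unitI R) (coded_mmSpace h) (coded_mmSpace g)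
    (coding_mfun h) (coding_mfun g) (2 * r)%R) => // s t.
    rewrite !mdist_coding_pi mulrA -natrM; exact: exc_dist_distortion.
  rewrite !mdist_coding_pi mulrA -natrM; exact: exc_dist_distortion.
- by rewrite gt0_muley ?leey// lte_fin.
- by have := hgr point.
Qed.
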